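(* For every real quadratic irrational $\alpha$ that is not a noble number, $\mathbf J_{\mathbb R}(\alpha^* )=\mathbf J_{\mathbb R}(\alpha)^*$, where $*$ denotes Galois conjugation of real quadratic irrationals.
   Context: Write $\widehat{\mathbb R}=\mathbb R\cup\{\infty\}$. Definition of $\mathbf J_{\mathbb R}$: An infinite binary string $a\in\{0,1\}^\omega$ is written $a=0^{n_0}1^{n_1}0^{n_2}1^{n_3}\cdots$ with $n_0\ge 0$ and $n_i\ge 1$ for $i\ge1$; if $a$ is eventually constant the list of exponents is finite and its last entry is $\infty$. Put $\kappa(a)=[n_0,n_1,n_2,\dots]=n_0+\cfrac1{n_1+\cfrac1{n_2+\cdots}}\in[0,\infty]$, with $1/\infty=0$ and $[\infty]=\infty$. This is a bijection from not-eventually-constant strings to positive irrationals. Let $\phi=(01)^\omega=0101\dots$, $\phi^*=(10)^\omega=1010\dots$, and let $\oplus$ be term-wise exclusive or. The map $\mathbf J_{\mathbb R}:\mathbb R\setminus\mathbb Q\to\widehat{\mathbb R}$ is: if $x>0$ is irrational and $x=\kappa(a)$, then $\mathbf J_{\mathbb R}(x)=\kappa(a\oplus\phi)$; if $x<0$ is irrational and $-1/x=\kappa(a)$, then $\mathbf J_{\mathbb R}(x)=-1/\kappa(a\oplus\phi^* )$ (with $1/0=\infty$, $1/\infty=0$). Noble numbers are the elements of the orbit of the golden section $\Phi=(1+\sqrt5)/2$ under $\mathrm{PGL}_2(\mathbb Z)$ acting by Möbius maps. If $\alpha$ is a real quadratic irrational that is not noble, then $\mathbf J_{\mathbb R}(\alpha)$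 is again a real quadratic irrational, so its conjugate is defined. *)

(* Defs.v *)
(* MathComp-Analysis; the real line is an arbitrary R : realType. *)
From mathcomp Require Import all_boot all_order all_algebra.
From mathcomp Require Import all_classical all_reals all_analysis.

Set Implicit Arguments.
Unset Strict Implicit.
Unset Printing Implicit Defensive.

Import Order.TTheory GRing.Theory Num.Theory.
Import numFieldNormedType.Exports.

Local Open Scope classical_set_scope.
Local Open Scope ring_scope.

(* The letters 0 and 1 are [false] and [true]. *)
Definition string := nat -> bool.

Definition xorS (a b : string) : string := fun k => a k (+) b k.

(* phi = 0101..., phi^* = 1010... *)
Definition phi : string := fun k => odd k.
Definition phi_star : string := fun k => ~~ odd k.

(* Length of the maximal prefix of [a] all of whose letters are [b]; [None]
   stands for infinity. *)
Definition prefix_run (b : bool) (a : string) : option nat :=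
  if pselect (exists k, a k != b) is left ex then Some (ex_minn ex) else None.

(* [exponents false a i] is n_i, where a = 0^{n_0} 1^{n_1} 0^{n_2} ....
   For an eventually constant [a] the list of exponents ends with infinity;
   here it is continued by infinities, which do not affect the value of the
   continued fraction. *)
Fixpoint exponents (b : bool) (a : string) (i : nat) : option nat :=
  match prefix_run b a, i with
  | None, _ => None
  | Some k, 0 => Some k
  | Some k, j.+1 => exponents (~~ b) (fun m => a (k + m)%N) j
  end.

(* The one-point compactification of the real line; [None] is infinity. *)
Definition hatR (R : realType) : Type := option R.

Section Jimm.
Variable R : realType.

Definition natbar (n : option nat) : \bar R :=
  if n is Some k then (k%:R)%:E else +oo%E.

(* [convergent n N] = n_0 + 1/(n_1 + 1/(... + 1/n_N)) in [0, +oo]. The inverse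
   of the library satisfies 0^-1 = +oo and +oo^-1 = 0. *)
Fixpoint convergent (n : nat -> option nat) (N : nat) : \bar R :=
  if N is M.+1 then
    (natbar (n 0%N) + (convergent (fun i => n i.+1) M)^-1)%E
  else natbar (n 0%N).

Definition kappa (a : string) : \bar R :=
  lim (convergent (exponents false a) N @[N --> \oo]).

(* Used only on [0, +oo] and [-oo, 0]. *)
Definition to_hatR (x : \bar R) : hatR R := if x is r%:E then Some r else None.

(* The string with the given (positive irrational) value; it is unique. *)
Definition kappa_inv (x : R) : string := get [set a | kappa a = x%:E].

(* Meaningful for irrational [x] only. In the second case, kappa = 0 gives
   - +oo = -oo, and kappa = +oo gives 0. *)
Definition J (x : R) : hatR R :=
  if 0 < x then to_hatR (kappa (xorS (kappa_inv x) phi))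
  else to_hatR (- (kappa (xorS (kappa_inv (- x^-1)) phi_star))^-1)%E.

Definition quadratic_root (P : {poly rat}) (x : R) : Prop :=
  size P = 3%N /\ root (map_poly ratr P) x.

Definition quadratic_irrational (x : R) : Prop :=
  irrational x /\ exists P : {poly rat}, quadratic_root P x.

(* The other root of the minimal polynomial of [x] over the rationals, which,
   for a quadratic irrational [x], is the only quadratic polynomial vanishing
   at [x] up to scaling. *)
Definition conjugate (x : R) : R :=
  get [set y | y != x /\
    exists P : {poly rat}, quadratic_root P x /\ quadratic_root P y].

Definition golden : R := (1 + Num.sqrt 5) / 2.

(* The denominator is nonzero when [M] is invertible and [x] irrational. *)
Definition mobius (M : 'M[int]_2) (x : R) : R :=
  ((M 0 0)%:~R * x + (M 0 1)%:~R) / ((M 1 0)%:~R * x + (M 1 1)%:~R).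

Definition noble (x : R) : Prop :=
  exists M : 'M[int]_2, M \in unitmx /\ x = mobius M golden.

End Jimm.

(* Main.v *)
Require Import Defs.
From mathcomp Require Import all_boot all_order all_algebra.
From mathcomp Require Import all_classical all_reals all_analysis.
From mathcomp Require Import ring lra zify.

(** A positive real x is represented by the point t = x / (1 + x) of [0, 1].
    In this coordinate the letters of a string act as the inverse branches
    t |-> 1 / (2 - t) (letter 0, that is x |-> x + 1) and t |-> t / (1 + t)
    (letter 1, that is x |-> x / (x + 1)) of the Farey map, [kappa] becomes the
    coding of [0, 1] by itineraries of this map ([kappaE]), and complementing
    all letters becomes t |-> 1 - t.

    The xor with 0101... turns a prepended letter into the same letter followed
    by a complementation.  Hence, if [p : q] are homogeneous coordinates of
    J(x), then [p + q : p], [q : p] and [- q : p] are homogeneous coordinates of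
    J(x + 1), J(1 / x) and J(- x), for every irrational x and whatever its sign
    ([J_add1], [J_inv], [J_opp]): J intertwines the action of PGL_2(Z) with its
    composition with an outer automorphism.

    Let now alpha be a quadratic irrational with conjugate z.  Expand |alpha|
    and apply the letters obtained to the conjugate as well.  As in Lagrange's
    theorem, the conjugate becomes negative at some point, after which the
    integral quadratic equations satisfied by the pair have bounded
    coefficients; so the pair of conjugates is eventually periodic
    ([exists_period]).  A period is a nonempty word fixing both members of the
    pair; through J it becomes a product of the matrices (1 1; 1 0) and
    (0 1; 1 1), which is not scalar, and fixes the images of both.  Therefore
    J(alpha) and J(z) are zeros of one nonzero integral binary quadratic form
    ([conjugates_share_form]).

    It remains to see that J(alpha) is irrational and differs from J(z).  If
    J(alpha) is rational or infinite, the twisted code of alpha is eventually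
    constant, so that the code of alpha eventually alternates, and alpha is
    noble ([J_irrational]).  And J preserves signs, while an irrational has only
    one code, so that J takes an irrational value at most once
    ([J_irrational_inj]).  The form above is then, up to a factor, the minimal
    polynomial of J(alpha), and J(z) is its other root. *)

Set Implicit Arguments.
Unset Strict Implicit.
Unset Printing Implicit Defensive.

Import Order.TTheory GRing.Theory Num.Theory.
Import numFieldNormedType.Exports.

Local Open Scope classical_set_scope.
Local Open Scope ring_scope.

(** * Coding the unit interval by the Farey map *)

Definition tail (a : string) : string := fun k => a k.+1.

Definition cons_string (b : bool) (a : string) : string :=
  fun k => if k is j.+1 then a j else b.

Definition complement (a : string) : string := fun k => ~~ a k.

Section Farey.
Variable R : realType.
Implicit Types (s t x y d : R) (b : bool) (a : string).

(** The order isomorphism from [0, +oo] to [0, 1]; the x coordinate of t is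
    t / (1 - t). *)
Definition unit_coord x : R := x / (1 + x).

(** The Moebius maps x |-> x + 1 (letter 0) and x |-> x / (x + 1) (letter 1),
    read in the coordinate [unit_coord]. *)
Definition branch (b : bool) t : R := if b then t / (1 + t) else (2 - t)^-1.

Fixpoint cylinder (k : nat) (a : string) t : R :=
  if k is j.+1 then branch (a 0%N) (cylinder j (tail a) t) else t.

(** The common point of all the cylinders of [a]; it is [unit_coord] of
    [kappa a], by [kappaE] below. *)
Definition value a : R := sup [set cylinder k a 0 | k in [set: nat]].

Lemma branch_in01 b t : 0 <= t <= 1 -> 0 <= branch b t <= 1.
Proof.
move=> /andP[t0 t1]; case: b => /=.
  by rewrite divr_ge0 ?ler_pdivrMr ?mul1r //=; lra.
by rewrite invr_ge0 invf_le1; lra.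
Qed.

Lemma branch_compl b t : 0 <= t <= 1 -> branch (~~ b) (1 - t) = 1 - branch b t.
Proof.
move=> /andP[t0 t1]; case: b => /=; field; lra.
Qed.

Lemma branch_le b s t : 0 <= s -> s <= t -> t <= 1 -> branch b s <= branch b t.
Proof.
move=> s0 st t1; case: b => /=; last by rewrite lef_pV2 ?posrE; lra.
rewrite ler_pdivrMr; last lra.
rewrite mulrAC ler_pdivlMr; last lra.
nra.
Qed.

(** The branches are not uniformly contracting, having derivative 1 at 0 or at
    1.  But on [0, 1] the inverse of the distance of two points grows by at
    least 1 under each branch, which makes cylinders shrink like 1 / k. *)
Lemma branch_contract b s t d : 0 <= s <= 1 -> 0 <= t <= 1 ->
  `|s - t| <= d -> `|branch b s - branch b t| <= d / (1 + d).
Proof.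
wlog st : s t / t <= s => [hw|].
  move=> hs ht; case: (leP t s) => [ts|/ltW ts]; first exact: hw.
  by rewrite distrC => ?; rewrite distrC; exact: hw.
move=> /andP[s0 s1] /andP[t0 t1]; rewrite ger0_norm ?subr_ge0 // => std.
have d0 : 0 <= d by lra.
rewrite ger0_norm ?subr_ge0 ?branch_le // ler_pdivlMr; last lra.
case: b => /=.
  have -> : s / (1 + s) - t / (1 + t) = (s - t) / ((1 + s) * (1 + t)).
    by field; apply/andP; split; lra.
  rewrite mulrAC ler_pdivrMr; last by apply: mulr_gt0; lra.
  have := mulr_ge0 d0 t0; have := mulr_ge0 d0 (mulr_ge0 s0 t0); nra.
have -> : (2 - s)^-1 - (2 - t)^-1 = (s - t) / ((2 - s) * (2 - t)).
  by field; apply/andP; split; lra.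
rewrite mulrAC ler_pdivrMr; last by apply: mulr_gt0; lra.
have s1' : 0 <= 1 - s by lra.
have t1' : 0 <= 1 - t by lra.
have := mulr_ge0 d0 s1'; have := mulr_ge0 d0 (mulr_ge0 s1' t1'); nra.
Qed.

Lemma branch_inj b s t : 0 <= s <= 1 -> 0 <= t <= 1 ->
  branch b s = branch b t -> s = t.
Proof.
move=> hs ht; case: b => /= e; last first.
  by have := invr_inj e; lra.
have := congr1 (fun u => u * ((1 + s) * (1 + t))) e.
have -> : s / (1 + s) * ((1 + s) * (1 + t)) = s * (1 + t) by field; lra.
have -> : t / (1 + t) * ((1 + s) * (1 + t)) = t * (1 + s) by field; lra.
lra.
Qed.

Lemma cylinder_in01 k a t : 0 <= t <= 1 -> 0 <= cylinder k a t <= 1.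
Proof. by elim: k a => //= k IHk a /IHk ?; exact: branch_in01. Qed.

Lemma cylinder_width k a s t : 0 <= s <= 1 -> 0 <= t <= 1 ->
  `|cylinder k a s - cylinder k a t| <= k.+1%:R^-1.
Proof.
move=> hs ht; elim: k a => [|k IHk] a /=.
  by rewrite invr1 ler_norml; lra.
apply: le_trans (branch_contract _ _ _ (IHk _)) _; rewrite ?cylinder_in01 //.
have : 0 < k.+1%:R :> R by rewrite ltr0n.
rewrite -[k.+2%:R]natr1; move: (k.+1%:R) => n n0.
suff -> : n^-1 / (1 + n^-1) = (n + 1)^-1 by [].
by field; apply/andP; split; lra.
Qed.

Lemma cylinder_nested j k a : cylinder j a 0 <= cylinder k a 1.
Proof.
have h0 : 0 <= (0 : R) <= 1 by lra.
have h1 : 0 <= (1 : R) <= 1 by lra.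
elim: j k a => [|j IHj] [|k] a //.
- by have /andP[] := cylinder_in01 k.+1 a h1.
- by have /andP[] := cylinder_in01 j.+1 a h0.
have /andP[c0 _] := cylinder_in01 j (tail a) h0.
have /andP[_ c1] := cylinder_in01 k (tail a) h1.
exact: branch_le.
Qed.

Lemma value_between k a : cylinder k a 0 <= value a <= cylinder k a 1.
Proof.
have ne : [set cylinder k a 0 | k in [set: nat]] !=set0.
  by exists (cylinder 0 a 0), 0%N.
have ub j : ubound [set cylinder k a 0 | k in [set: nat]] (cylinder j a 1).
  by move=> _ [i _ <-]; exact: cylinder_nested.
apply/andP; split; last exact: ge_sup.
by apply: sup_upper_bound; [split=> //; exists (cylinder 0 a 1)|exists k].
Qed.

Lemma value_in01 a : 0 <= value a <= 1.
Proof. exact: (value_between 0). Qed.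

Lemma value_near k a s : 0 <= s <= 1 ->
  `|value a - cylinder k a s| <= 2 / k.+1%:R.
Proof.
move=> hs; have h0 : 0 <= (0 : R) <= 1 by lra.
have h1 : 0 <= (1 : R) <= 1 by lra.
have := value_between k a.
have := cylinder_width k a h0 h1; have := cylinder_width k a hs h0.
rewrite !ler_norml; move: (k.+1%:R^-1) => e; lra.
Qed.

Lemma eq_of_near s t (C : R) :
  (forall k : nat, `|s - t| <= C / k.+1%:R) -> s = t.
Proof.
move=> st; apply/eqP; rewrite -subr_eq0 -normr_le0 leNgt; apply/negP => e0.
have C0 : 0 <= C by have := st 0%N; rewrite divr1; exact: le_trans.
have := archi_boundP (divr_ge0 C0 (ltW e0)); set n := Num.bound _ => hn.
have := st n; rewrite ler_pdivlMr ?ltr0n // -natr1.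
move: hn; rewrite ltr_pdivrMr //; nra.
Qed.

Lemma value_unique a t :
  (forall k, exists2 s, 0 <= s <= 1 & t = cylinder k a s) -> t = value a.
Proof.
move=> ht; apply: (@eq_of_near _ _ 2) => k; have [s hs ->] := ht k.
by rewrite distrC; exact: value_near.
Qed.

Lemma value_branch a : value a = branch (a 0%N) (value (tail a)).
Proof.
apply: (@eq_of_near _ _ 4) => k; have h0 : 0 <= (0 : R) <= 1 by lra.
have h1 := value_near k.+1 a h0.
have h2 : `|cylinder k.+1 a 0 - branch (a 0%N) (value (tail a))|
    <= 2 / k.+1%:R / (1 + 2 / k.+1%:R).
  apply: branch_contract; rewrite ?value_in01 ?cylinder_in01 //.
  by rewrite distrC value_near.
apply: (le_trans (ler_distD (cylinder k.+1 a 0) _ _)).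
have k0 : 0 < k.+1%:R^-1 :> R by rewrite invr_gt0 ltr0n.
have h3 : 2 / k.+1%:R / (1 + 2 / k.+1%:R) <= 2 / k.+1%:R :> R.
  move: (k.+1%:R^-1) k0 => e e0; rewrite ler_pdivrMr; last lra.
  by have := mulr_gt0 e0 e0; lra.
have h4 : 2 / k.+2%:R <= 2 / k.+1%:R :> R.
  by rewrite ler_pM2l ?lef_pV2 ?posrE ?ltr0n // ler_nat.
apply: le_trans (lerD h1 (le_trans h2 h3)) _.
by move: (k.+1%:R^-1) (k.+2%:R^-1) h4 => e e' h4; lra.
Qed.

Lemma value_cons b a : value (cons_string b a) = branch b (value a).
Proof. by rewrite value_branch. Qed.

Lemma cylinder_compl k a t : 0 <= t <= 1 ->
  cylinder k (complement a) (1 - t) = 1 - cylinder k a t.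
Proof.
move=> ht; elim: k a => //= k IHk a.
by rewrite [tail _]/(complement (tail a)) IHk branch_compl ?cylinder_in01.
Qed.

Lemma value_compl a : value (complement a) = 1 - value a.
Proof.
have h0 : 0 <= (0 : R) <= 1 by lra.
have h1 : 0 <= (1 : R) <= 1 by lra.
apply: (@eq_of_near _ _ 4) => k.
have := value_near k (complement a) h1.
have := value_near k a h0.
have := cylinder_compl k a h0; rewrite subr0 => ->.
rewrite !ler_norml; move: (k.+1%:R^-1) => e; lra.
Qed.

(** The Farey map is the inverse of [branch b] on the half of [0, 1] covered by
    that branch; recording the half visited at each step gives a code. *)
Definition choose_branch t : bool := t < 2^-1.
Definition inv_branch t : R :=
  if choose_branch t then t / (1 - t) else 2 - t^-1.
Definition itinerary t : string := fun k => choose_branch (iter k inv_branch t).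

Lemma inv_branch_in01 t : 0 <= t <= 1 -> 0 <= inv_branch t <= 1.
Proof.
rewrite /inv_branch /choose_branch; case: ltP => h /andP[t0 t1].
  by rewrite divr_ge0 ?ler_pdivrMr //=; lra.
have : 1 <= t^-1 by rewrite invf_ge1 //; lra.
have : t^-1 <= 2 by rewrite invf_ple ?posrE //; lra.
lra.
Qed.

Lemma inv_branchK t : 0 <= t <= 1 ->
  branch (choose_branch t) (inv_branch t) = t.
Proof.
rewrite /inv_branch /choose_branch; case: ltP => h /andP[t0 t1] /=; last first.
  by rewrite subKr invrK.
by field; apply/andP; split; lra.
Qed.

Lemma itinerary_cylinder k t : 0 <= t <= 1 ->
  t = cylinder k (itinerary t) (iter k inv_branch t).
Proof.
elim: k t => //= k IHk t ht.
have -> : tail (itinerary t) = itinerary (inv_branch t).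
  by apply/funext => j; rewrite /tail /itinerary iterSr.
rewrite -iterS iterSr -IHk ?inv_branch_in01 //.
by rewrite [itinerary t 0%N]/(choose_branch t) inv_branchK.
Qed.

Lemma value_itinerary t : 0 <= t <= 1 -> value (itinerary t) = t.
Proof.
move=> ht; apply/esym/value_unique => k; exists (iter k inv_branch t).
  by elim: k => //= k; exact: inv_branch_in01.
exact: itinerary_cylinder.
Qed.

End Farey.

(** * The continued fraction of the run lengths *)

Lemma prefix_run_diff b (a : string) : a 0%N = ~~ b ->
  prefix_run b a = Some 0%N.
Proof.
move=> a0; rewrite /prefix_run; case: pselect => [ex|]; last first.
  by case; exists 0%N; rewrite a0; case: b {a0}.
case: ex_minnP => m _ /(_ 0%N); rewrite a0 leqn0 => /(_ _)/eqP-> //.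
by case: b {a0 ex}.
Qed.

Lemma prefix_run_same b (a : string) : a 0%N = b ->
  prefix_run b a = omap succn (prefix_run b (tail a)).
Proof.
move=> a0; rewrite /prefix_run.
case: pselect => [ex|nex]; case: pselect => [ex'|nex'] //=; last 2 first.
- by case: nex'; case: ex => -[|k] hk; [rewrite a0 eqxx in hk|exists k].
- by case: nex; case: ex' => k hk; exists k.+1.
congr Some; case: ex_minnP => m hm mmin; case: ex_minnP => n hn nmin.
apply/eqP; rewrite eqn_leq mmin //=.
by case: m hm {mmin} => [|m] hm; [rewrite a0 eqxx in hm|rewrite ltnS nmin].
Qed.

Section Kappa.
Variable R : realType.
Implicit Types (s t x y : R) (b : bool) (a : string).

Local Notation run_convergent b a N := (convergent R (exponents b a) N).

Lemma convergent_ge0 (n : nat -> option nat) N : (0 <= convergent R n N)%E.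
Proof.
have nb k : (0 <= natbar R k)%E by case: k => [k|] //=; rewrite lee_fin ler0n.
by elim: N n => [|N IHN] n //=; rewrite adde_ge0 // inve_ge0.
Qed.

Lemma convergent_same b a N : a 0%N = b ->
  run_convergent b a N = (1 + run_convergent b (tail a) N)%E.
Proof.
move=> a0; have h0 : natbar R (exponents b a 0) =
    (1 + natbar R (exponents b (tail a) 0))%E.
  rewrite /= prefix_run_same //; case: (prefix_run b (tail a)) => [k|] //=.
  by rewrite -natr1 addrC.
case: N => [|N]; first exact: h0.
rewrite [LHS]/= [X in (1 + X)%E]/=; rewrite /= in h0.
rewrite h0 addeA; congr (_ + (convergent _ _ _)^-1)%E; apply/funext => i /=.
by rewrite prefix_run_same //; case: (prefix_run b (tail a)).
Qed.

Lemma convergent_diff b a N : a 0%N = ~~ b ->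
  run_convergent b a N.+1 = ((run_convergent (~~ b) a N)^-1)%E.
Proof. by move=> a0; rewrite /= prefix_run_diff //= add0e. Qed.

Lemma contract_add1 (x : \bar R) : (0 <= x)%E ->
  contract (1 + x)%E = branch false (contract x).
Proof.
case: x => [r||] //=; last first.
  by move=> _; rewrite (_ : 2 - 1 = 1) ?invr1 //; ring.
rewrite lee_fin => r0; rewrite !ger0_norm; try lra.
by field; apply/andP; split; lra.
Qed.

Lemma contract_inv (x : \bar R) : (0 <= x)%E ->
  contract (x^-1)%E = 1 - contract x.
Proof.
case: x => [r||] //; last by rewrite invey contract0 /= subrr.
rewrite lee_fin => r0; rewrite inver; case: eqP => [->|/eqP rn0] /=.
  by rewrite mul0r subr0.
have {}r0 : 0 < r by lra.
have ri0 : 0 < r^-1 by rewrite invr_gt0.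
rewrite !ger0_norm; try lra.
by field; rewrite rn0; apply/andP; split; lra.
Qed.

Lemma contract_same b a N : a 0%N = b ->
  contract (run_convergent b a N) =
  branch false (contract (run_convergent b (tail a) N)).
Proof.
by move=> a0; rewrite convergent_same ?contract_add1 ?convergent_ge0.
Qed.

Lemma contract_diff b a N : a 0%N = ~~ b ->
  contract (run_convergent b a N.+1) =
  1 - branch false (contract (run_convergent (~~ b) (tail a) N)).
Proof.
move=> a0; rewrite convergent_diff // contract_inv ?convergent_ge0 //.
by rewrite contract_same.
Qed.

(** The N-th convergent lies in the cylinder of [a] of depth N, since each of
    its terms absorbs at least one letter, except perhaps n_0.  The second half
    concerns the inverse of the continued fraction read from the runs of 1; it
    is what the first half needs when the leading run of 0 is empty. *)
Lemma convergent_cylinder k N a : (k <= N)%N ->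
  (exists2 s, 0 <= s <= 1 &
    contract (run_convergent false a N) = cylinder k a s) /\
  (exists2 s, 0 <= s <= 1 &
    1 - contract (run_convergent true a N) = cylinder k a s).
Proof.
have c01 n M : 0 <= contract (convergent R n M) <= 1.
  have := contract_le1 (convergent R n M).
  have : contract 0 <= contract (convergent R n M).
    by rewrite le_contract convergent_ge0.
  by rewrite contract0 ler_norml; lra.
have c01N n M : 0 <= 1 - contract (convergent R n M) <= 1.
  by have := c01 n M; lra.
elim: k N a => [|k IHk] N a kN.
  split; first by exists (contract (run_convergent false a N)).
  by exists (1 - contract (run_convergent true a N)).
case: N kN => // N kN.
have [[s hs es] [u hu eu]] := IHk N.+1 (tail a) (leqW kN).
have [[s' hs' es'] [u' hu' eu']] := IHk N (tail a) kN.
case a0: (a 0%N); split.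
- by exists u' => //; rewrite [RHS]/= a0 contract_diff // -eu' -branch_compl.
- by exists u => //; rewrite [RHS]/= a0 contract_same // -eu -branch_compl.
- by exists s => //; rewrite [RHS]/= a0 contract_same // -es.
- by exists s' => //; rewrite [RHS]/= a0 contract_diff // -es' subKr.
Qed.

(** The distance defining the topology of the extended reals is that of the
    images under [contract], which is [unit_coord] on nonnegative elements; so
    the shrinking of cylinders gives the convergence of the convergents. *)
Lemma kappaE a : kappa R a = expand (value R a).
Proof.
rewrite /kappa; apply: cvg_lim; first exact: ereal_hausdorff.
have v01 := value_in01 R a.
apply/cvg_ballP => e e0.
near=> N; rewrite /ball /= /ereal_ball expandK; last first.
  by rewrite inE ler_norml; lra.
have [[s hs ->] _] := @convergent_cylinder N N a (leqnn N).
apply: le_lt_trans (value_near _ _ hs) _.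
rewrite ltr_pdivrMr ?ltr0n // mulrC -ltr_pdivrMr // -natr1.
have : 2 / e <= N%:R by near: N; exact: nbhs_infty_ger.
lra.
Unshelve. all: by end_near.
Qed.

Lemma contract_kappa a : contract (kappa R a) = value R a.
Proof.
rewrite kappaE expandK // inE ler_norml.
by have := value_in01 R a; lra.
Qed.

Lemma kappa_eq a x : 0 <= x -> kappa R a = x%:E <-> value R a = unit_coord x.
Proof.
move=> x0; rewrite -contract_kappa; split=> [->/=|e].
  by rewrite ger0_norm.
by apply: contract_inj; rewrite e /= ger0_norm.
Qed.

End Kappa.

(** * Codes of irrational numbers *)

Section Rational.
Variable R : realType.
Implicit Types x y : R.

Lemma rational_rat (q : rat) : rational (ratr q : R).
Proof. by exists q. Qed.

Lemma rational_int (n : int) : rational (n%:~R : R).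
Proof. by exists n%:~R => //; rewrite ratr_int. Qed.

Lemma rational_nat (n : nat) : rational (n%:R : R).
Proof. by exists n%:R => //; rewrite ratr_nat. Qed.

Lemma rational1 : rational (1 : R). Proof. exact: (rational_nat 1). Qed.

Lemma rationalD x y : rational x -> rational y -> rational (x + y).
Proof. by move=> [p _ <-] [q _ <-]; exists (p + q); rewrite // rmorphD. Qed.

Lemma rationalN x : rational x -> rational (- x).
Proof. by move=> [p _ <-]; exists (- p); rewrite // rmorphN. Qed.

Lemma rationalM x y : rational x -> rational y -> rational (x * y).
Proof. by move=> [p _ <-] [q _ <-]; exists (p * q); rewrite // rmorphM. Qed.

Lemma rationalV x : rational x -> rational x^-1.
Proof. by move=> [p _ <-]; exists p^-1; rewrite // fmorphV. Qed.

Lemma irrational_neq x y : irrational x -> rational y -> x != y.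
Proof. by move=> xi yr; apply/eqP => e; apply: xi; rewrite e. Qed.

Lemma irrational_addr1 x : irrational x -> irrational (x + 1).
Proof.
move=> xi xr; apply: xi; rewrite -(addrK 1 x).
exact: rationalD xr (rationalN rational1).
Qed.

Lemma irrationalV x : irrational x -> irrational x^-1.
Proof. by move=> xi xr; apply: xi; rewrite -(invrK x); exact: rationalV. Qed.

Lemma irrationalN x : irrational x -> irrational (- x).
Proof. by move=> xi xr; apply: xi; rewrite -(opprK x); exact: rationalN. Qed.

Lemma rational_branch b x : rational x -> rational (branch b x).
Proof.
move=> xr; have r2 := rational_nat 2; case: b => /=.
  exact: rationalM xr (rationalV (rationalD rational1 xr)).
exact: rationalV (rationalD r2 (rationalN xr)).
Qed.

Lemma rational_unit_coord x : 0 < x -> rational (unit_coord x) -> rational x.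
Proof.
move=> x0 xr; have -> : x = unit_coord x / (1 - unit_coord x).
  by rewrite /unit_coord; field; apply/andP; split; lra.
exact: rationalM xr (rationalV (rationalD rational1 (rationalN xr))).
Qed.

Lemma unit_coord_in01 x : 0 < x -> 0 <= unit_coord x <= 1.
Proof.
by move=> x0; rewrite /unit_coord divr_ge0 ?ler_pdivrMr ?mul1r //=; lra.
Qed.

(** The images of the two branches only meet at 1/2, which is rational. *)
Lemma value_head a b : irrational (value R a) -> value R a = value R b ->
  a 0%N = b 0%N.
Proof.
rewrite value_branch (value_branch R b) => ai e.
apply/eqP/negPn/negP => ab; apply: ai.
have := value_in01 R (tail a); have := value_in01 R (tail b).
move: (value R (tail a)) (value R (tail b)) e => s t e.
move=> /andP[t0 t1] /andP[s0 s1].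
have lo u : 0 <= u -> u <= 1 -> branch true u <= 2^-1.
  by move=> u0 u1; rewrite ler_pdivrMr; lra.
have hi u : 0 <= u -> u <= 1 -> 2^-1 <= branch false u.
  by move=> u0 u1; rewrite lef_pV2 ?posrE; lra.
suff -> : branch (a 0%N) s = 2^-1 by exact: rationalV (rational_nat 2).
case: (a 0%N) (b 0%N) ab e => -[] // _ e; apply/eqP; rewrite eq_le.
  by rewrite lo // e hi.
by rewrite hi // e lo.
Qed.

Lemma value_inj a b : irrational (value R a) -> value R a = value R b -> a = b.
Proof.
move=> ai e; apply/funext => k; elim: k a b ai e => [|k IHk] a b ai e.
  exact: value_head.
apply: (IHk (tail a) (tail b)).
  by move=> r; apply: ai; rewrite value_branch; exact: rational_branch.
have hd := value_head ai e; move: e.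
rewrite value_branch (value_branch R b) hd.
by apply: branch_inj; exact: value_in01.
Qed.

Lemma kappa_invE a x : 0 < x -> irrational x -> value R a = unit_coord x ->
  kappa_inv x = a.
Proof.
move=> x0 xi va; rewrite /kappa_inv; apply: get_unique => /=.
  by apply/kappa_eq => //; exact: ltW.
move=> b /(kappa_eq _ (ltW x0)) vb; apply/esym/value_inj; last by rewrite va vb.
by rewrite va => /(rational_unit_coord x0).
Qed.

End Rational.

(** * Functional equations of J *)

Section Homogeneous.
Variable R : realType.
Implicit Types (p q c x : R) (h : hatR R).

(** [p : q] are homogeneous coordinates of [h] on the projective line. *)
Definition homogeneous h p q : Prop :=
  if h is Some r then q != 0 /\ p = r * q else p != 0 /\ q = 0.

Lemma homogeneous_unique h p q p' q' : homogeneous h p q ->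
  homogeneous h p' q' -> exists c, [/\ c != 0, p' = c * p & q' = c * q].
Proof.
case: h => [r|] /= [n0 e] [n0' e'].
  exists (q' / q); split; first by rewrite mulf_neq0 ?invr_eq0.
    by rewrite e e'; field.
  by field.
exists (p' / p); split; first by rewrite mulf_neq0 ?invr_eq0.
  by field.
by rewrite e e' mulr0.
Qed.

Lemma homogeneous_scale h p q c : c != 0 -> homogeneous h p q ->
  homogeneous h (c * p) (c * q).
Proof.
move=> c0; case: h => [r|] /= [n0 ->]; split; rewrite ?mulf_neq0 //; ring.
Qed.

Lemma homogeneous_eq h p q p' q' c : homogeneous h p' q' ->
  c != 0 -> p = c * p' -> q = c * q' -> homogeneous h p q.
Proof. by move=> hh c0 -> ->; exact: homogeneous_scale. Qed.

Lemma homogeneous_exists h : exists p q, homogeneous h p q.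
Proof.
case: h => [r|]; first by exists r, 1; rewrite /= oner_neq0 mulr1.
by exists 1, 0; rewrite /= oner_neq0.
Qed.

(** The two lemmas below give the coordinates of the values taken by the two
    cases in the definition of [J]. *)
Lemma homogeneous_expand p : 0 <= p <= 1 ->
  homogeneous (to_hatR (expand p)) p (1 - p).
Proof.
move=> /andP[p0 p1]; rewrite /expand; case: leP => h1.
  have -> : p = 1 by lra.
  by rewrite /= oner_neq0 subrr.
rewrite ifF; last by lra.
rewrite /= ger0_norm //; split; first by lra.
by field; lra.
Qed.

Lemma homogeneous_oppV p : 0 <= p <= 1 ->
  homogeneous (to_hatR (- (expand p)^-1)%E) (p - 1) p.
Proof.
move=> /andP[p0 p1]; rewrite /expand; case: leP => h1.
  rewrite invey oppe0; have -> : p = 1 by lra.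
  by rewrite /= oner_neq0 subrr mul0r.
rewrite ifF; last by lra.
rewrite ger0_norm // inver; case: eqP => [/eqP|/eqP].
  rewrite mulf_eq0 invr_eq0 => /orP[/eqP->|/eqP]; last lra.
  by rewrite /=; split => //; lra.
rewrite mulf_eq0 negb_or => /andP[pn0 _] /=; split => //.
by field; rewrite pn0 /=; lra.
Qed.

End Homogeneous.

Lemma xor_phi_cons b (a : string) :
  xorS (cons_string b a) phi = cons_string b (complement (xorS a phi)).
Proof.
by apply/funext => -[|k]; rewrite /xorS /phi /complement /= ?addbF ?addbN.
Qed.

Lemma xor_phi_complement (a : string) :
  xorS (complement a) phi = complement (xorS a phi).
Proof. by apply/funext => k; rewrite /xorS /complement addNb. Qed.

Lemma xor_phi_star (a : string) : xorS a phi_star = complement (xorS a phi).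
Proof. by apply/funext => k; rewrite /xorS /complement -addbN. Qed.

Section JCoordinates.
Variable R : realType.
Implicit Types (x y p q : R) (a : string).

(** The point coded by the string that defines [J]; for negative numbers the
    xor with 1010... codes the reflected point [1 - twist a]. *)
Definition twist a : R := value R (xorS a phi).

Lemma twist_in01 a : 0 <= twist a <= 1. Proof. exact: value_in01. Qed.

Lemma twist_cons b a : twist (cons_string b a) = branch b (1 - twist a).
Proof. by rewrite /twist xor_phi_cons value_cons value_compl. Qed.

Lemma twist_compl a : twist (complement a) = 1 - twist a.
Proof. by rewrite /twist xor_phi_complement value_compl. Qed.

Lemma J_pos x a : 0 < x -> irrational x -> value R a = unit_coord x ->
  homogeneous (J x) (twist a) (1 - twist a).
Proof.
move=> x0 xi va; rewrite /J x0 (kappa_invE x0 xi va) kappaE.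
exact: homogeneous_expand (twist_in01 a).
Qed.

(** The hypothesis says that [a] is a code of - 1 / x, whose unit coordinate is
    1 / (1 - x). *)
Lemma J_neg x a : x < 0 -> irrational x -> value R a = (1 - x)^-1 ->
  homogeneous (J x) (- twist a) (1 - twist a).
Proof.
move=> x0 xi va; rewrite /J ltNge (ltW x0) /=.
have x0' : 0 < - x^-1 by rewrite oppr_gt0 invr_lt0.
rewrite (@kappa_invE _ a) //; last 2 first.
- exact/irrationalN/irrationalV.
- by rewrite va /unit_coord; field; rewrite !andbA; apply/andP; split; lra.
rewrite xor_phi_star kappaE value_compl -/(twist a).
rewrite [X in homogeneous _ X _](_ : _ = (1 - twist a) - 1); last by ring.
have hp : 0 <= 1 - twist a <= 1 by have := twist_in01 a; lra.
exact: homogeneous_oppV.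
Qed.

Lemma exists_code_pos x : 0 < x -> exists a, value R a = unit_coord x.
Proof.
move=> x0; exists (itinerary (unit_coord x)).
exact/value_itinerary/unit_coord_in01.
Qed.

Lemma exists_code x : 0 <= x <= 1 -> exists a, value R a = x.
Proof. by move=> x01; exists (itinerary x); exact: value_itinerary. Qed.

Lemma exists_code_neg x : x < 0 -> exists a, value R a = (1 - x)^-1.
Proof. by move=> x0; apply: exists_code; rewrite invr_ge0 invf_le1; lra. Qed.

(** Translation prepends the letter 0 to the code of a positive x, and removes
    the letter 1 from the code of - 1 / x when x < -1.  Between -1 and 0 the
    sign changes: if c is the code of the point 1 + x, then 0c is a code of
    - 1 / x and 1c is a code of x + 1. *)
Lemma J_add1 x p q : irrational x -> homogeneous (J x) p q ->
  homogeneous (J (x + 1)) (p + q) p.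
Proof.
move=> xi; suff [u [v [huv huv1]]] : exists u v,
    homogeneous (J x) u v /\ homogeneous (J (x + 1)) (u + v) u.
  move=> hpq; have [c [c0 -> ->]] := homogeneous_unique huv hpq.
  by rewrite -mulrDr; exact: homogeneous_scale.
have xi1 := irrational_addr1 xi.
have x0 : x != 0 := irrational_neq xi (rational_nat R 0).
have x1 : x != -1 := irrational_neq xi (rationalN (rational1 R)).
case: (ltgtP x 0) x0 => [xneg|xpos|->] //; last first.
  move=> _; have [a va] := exists_code_pos xpos.
  exists (twist a), (1 - twist a); split; first exact: J_pos.
  have := @J_pos (x + 1) (cons_string false a) _ xi1; rewrite value_cons va.
  rewrite twist_cons; have /andP[] := twist_in01 a.
  move: (twist a) => m m0 m1 /(_ _ _)h.
  apply: (homogeneous_eq (c := 1 + m) (h _ _)).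
  - lra.
  - by rewrite /unit_coord /=; field; apply/andP; split; lra.
  - lra.
  - by rewrite /=; field; lra.
  - by rewrite /=; field; lra.
move=> _; case: (ltgtP x (-1)) x1 => [xlt|xgt|->] // _.
  have [|a va] := @exists_code (- x)^-1.
    by rewrite invr_ge0 invf_le1; lra.
  have h := @J_neg (x + 1) a; have h' := @J_neg x (cons_string true a) xneg xi.
  rewrite twist_cons value_cons va in h'.
  have {}h' := h' _; have {}h := h _ xi1 _.
  have /andP[m0 m1] := twist_in01 a; move: (twist a) m0 m1 h h' => m m0 m1 h h'.
  exists (m - 1), 1; split.
    apply: (homogeneous_eq (c := 2 - m) (h' _)).
    - by rewrite /=; field; apply/andP; split; lra.
    - lra.
    - by rewrite /=; field; lra.
    - by rewrite /=; field; lra.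
  apply: (homogeneous_eq (c := -1) (h _ _)); [lra| |lra|lra|lra].
  by rewrite va; congr (_ ^-1); lra.
have [|a va] := @exists_code (1 + x); first lra.
have h := @J_pos (x + 1) (cons_string true a) _ xi1.
have h' := @J_neg x (cons_string false a) xneg xi.
rewrite !twist_cons !value_cons va in h h'.
have {}h' := h' _; have {}h := h _ _.
have /andP[m0 m1] := twist_in01 a; move: (twist a) m0 m1 h h' => m m0 m1 h h'.
exists (-1), m; split.
  apply: (homogeneous_eq (c := 1 + m) (h' _)).
  - by rewrite /=; congr (_ ^-1); lra.
  - lra.
  - by rewrite /=; field; lra.
  - by rewrite /=; field; lra.
apply: (homogeneous_eq (c := m - 2) (h _ _)).
- lra.
- by rewrite /unit_coord /=; field; lra.
- lra.
- by rewrite /=; field; lra.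
- by rewrite /=; field; lra.
Qed.

(** Both cases of the definition see the code complemented. *)
Lemma J_inv x p q : irrational x -> homogeneous (J x) p q ->
  homogeneous (J x^-1) q p.
Proof.
move=> xi; suff [u [v [huv huv1]]] : exists u v,
    homogeneous (J x) u v /\ homogeneous (J x^-1) v u.
  move=> hpq; have [c [c0 -> ->]] := homogeneous_unique huv hpq.
  exact: homogeneous_scale.
have xi1 := irrationalV xi.
have x0 : x != 0 := irrational_neq xi (rational_nat R 0).
case: (ltgtP x 0) (x0) => [xneg|xpos|->] // _.
  have [|a va] := @exists_code (1 - x)^-1.
    by rewrite invr_ge0 invf_le1; lra.
  exists (- twist a), (1 - twist a); split; first exact: J_neg.
  have := @J_neg x^-1 (complement a); rewrite twist_compl value_compl va.
  rewrite invr_lt0 => /(_ xneg xi1 _)h.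
  apply: (homogeneous_eq (c := -1) (h _)); [|lra|lra|lra].
  by field; rewrite x0 /=; apply/andP; split; lra.
have [a va] := exists_code_pos xpos.
exists (twist a), (1 - twist a); split; first exact: J_pos.
have := @J_pos x^-1 (complement a); rewrite twist_compl value_compl va.
rewrite invr_gt0 subKr; apply => //.
by rewrite /unit_coord; field; rewrite x0 /=; lra.
Qed.

(** The code of - 1 / x is the complement of the code of - x. *)
Lemma J_opp x p q : irrational x -> homogeneous (J x) p q ->
  homogeneous (J (- x)) (- q) p.
Proof.
move=> xi; suff [u [v [huv huv1]]] : exists u v,
    homogeneous (J x) u v /\ homogeneous (J (- x)) (- v) u.
  move=> hpq; have [c [c0 -> ->]] := homogeneous_unique huv hpq.
  by rewrite -mulrN; exact: homogeneous_scale.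
have xi1 := irrationalN xi.
have x0 : x != 0 := irrational_neq xi (rational_nat R 0).
case: (ltgtP x 0) (x0) => [xneg|xpos|->] // _.
  have [|a va] := @exists_code (1 - x)^-1.
    by rewrite invr_ge0 invf_le1; lra.
  exists (- twist a), (1 - twist a); split; first exact: J_neg.
  have := @J_pos (- x) (complement a); rewrite twist_compl value_compl va.
  rewrite oppr_gt0 => /(_ xneg xi1 _)h.
  apply: (homogeneous_eq (c := -1) (h _)); [|lra|lra|lra].
  by rewrite /unit_coord; field; lra.
have [a va] := exists_code_pos xpos.
exists (twist a), (1 - twist a); split; first exact: J_pos.
have := @J_neg (- x) (complement a); rewrite twist_compl value_compl va.
rewrite subKr oppr_lt0; apply => //.
by rewrite /unit_coord; field; lra.
Qed.

End JCoordinates.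

(** * Irrationality and injectivity *)

Section Injectivity.
Variable R : realType.
Implicit Types (x y : R) (a : string).

Lemma rational_coords (p q r : R) : p = r * q -> q != 0 ->
  rational p -> rational q -> rational r.
Proof.
move=> e q0 pr qr; have -> : r = p / q by rewrite e mulfK.
exact: rationalM pr (rationalV qr).
Qed.

Lemma xorS_inj a b : xorS a phi = xorS b phi -> a = b.
Proof.
by move=> e; apply/funext => k; have := congr1 (fun f => f k) e; exact: addIb.
Qed.

Lemma twist_inj a b : irrational (twist R a) -> twist R a = twist R b -> a = b.
Proof. by move=> ai e; apply/xorS_inj/(value_inj ai e). Qed.

Lemma unit_coord_inj x y : 0 < x -> 0 < y ->
  unit_coord x = unit_coord y -> x = y.
Proof.
move=> x0 y0 e; have := congr1 (fun u => u * ((1 + x) * (1 + y))) e.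
rewrite /unit_coord.
have -> : x / (1 + x) * ((1 + x) * (1 + y)) = x * (1 + y) by field; lra.
have -> : y / (1 + y) * ((1 + x) * (1 + y)) = y * (1 + x) by field; lra.
lra.
Qed.

(** [J] is nonnegative on positive numbers and nonpositive on negative ones, so
    equal irrational values force equal signs.  They then have equal twisted
    codes, hence come from equal codes. *)
Lemma J_irrational_inj x y (beta : R) : irrational x -> irrational y ->
  irrational beta -> J x = Some beta -> J y = Some beta -> x = y.
Proof.
move=> xi yi bi Jx Jy.
have x0 : x != 0 := irrational_neq xi (rational_nat R 0).
have y0 : y != 0 := irrational_neq yi (rational_nat R 0).
have b0 : beta != 0 := irrational_neq bi (rational_nat R 0).
have irr a : 1 - twist R a != 0 ->
    twist R a = beta * (1 - twist R a) \/
      - twist R a = beta * (1 - twist R a) ->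
    irrational (twist R a).
  move=> n0 ha tr; apply: bi.
  have tr1 : rational (1 - twist R a) := rationalD (rational1 R) (rationalN tr).
  by case: ha => e; apply: (rational_coords e n0) => //; exact: rationalN.
case: (ltgtP x 0) x0 => [xneg|xpos|->] // _;
  case: (ltgtP y 0) y0 => [yneg|ypos|->] // _.
- have [a va] := exists_code_neg xneg; have [b vb] := exists_code_neg yneg.
  have := J_neg xneg xi va; have := J_neg yneg yi vb.
  rewrite Jx Jy /= => -[nb eb] [na ea].
  have ab : twist R a = twist R b.
    by move: b0 nb na eb ea; move: (twist R a) (twist R b) => s t; clear; nra.
  have {}ab : a = b by apply: twist_inj ab; apply: irr => //; right.
  by have := invr_inj (etrans (esym va) (etrans (congr1 (value R) ab) vb)); lra.
- have [a va] := exists_code_neg xneg; have [b vb] := exists_code_pos ypos.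
  have := J_neg xneg xi va; have := J_pos ypos yi vb.
  rewrite Jx Jy /= => -[nb eb] [na ea].
  have := twist_in01 R a; have := twist_in01 R b.
  move: (twist R a) (twist R b) nb na eb ea => s t; nra.
- have [a va] := exists_code_pos xpos; have [b vb] := exists_code_neg yneg.
  have := J_pos xpos xi va; have := J_neg yneg yi vb.
  rewrite Jx Jy /= => -[nb eb] [na ea].
  have := twist_in01 R a; have := twist_in01 R b.
  move: (twist R a) (twist R b) nb na eb ea => s t; nra.
- have [a va] := exists_code_pos xpos; have [b vb] := exists_code_pos ypos.
  have := J_pos xpos xi va; have := J_pos ypos yi vb.
  rewrite Jx Jy /= => -[nb eb] [na ea].
  have ab : twist R a = twist R b.
    by move: b0 nb na eb ea; move: (twist R a) (twist R b) => s t; clear; nra.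
  have {}ab : a = b by apply: twist_inj ab; apply: irr => //; left.
  by apply: unit_coord_inj => //; rewrite -va -vb ab.
Qed.

End Injectivity.

Section Noble.
Variable R : realType.
Implicit Types (x y : R) (a : string).

Lemma value_eq0 a : value R a = 0 -> forall i, a i = true.
Proof.
move=> va i; elim: i a va => [|i IHi] a; rewrite value_branch.
  case: (a 0%N) => //= /eqP; rewrite invr_eq0.
  by have := value_in01 R (tail a); lra.
have := value_in01 R (tail a); case: (a 0%N) => /= v01 /eqP; last first.
  by rewrite invr_eq0; lra.
rewrite mulf_eq0 invr_eq0 => /orP[/eqP/(IHi (tail a))//|]; lra.
Qed.

Lemma value_eq1 a : value R a = 1 -> forall i, a i = false.
Proof.
move=> va i; have : value R (complement a) = 0 by rewrite value_compl va subrr.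
by move/value_eq0/(_ i); rewrite /complement; case: (a i).
Qed.

(** The Farey map does not increase the denominator of a rational number, and
    decreases it strictly inside (0, 1); so the itinerary reaches 0 or 1, whose
    only codes are constant. *)
Lemma rational_value_eventually_constant a : rational (value R a) ->
  exists k b, forall i, a (k + i)%N = b.
Proof.
(* Induction on a bound n of the denominator q. *)
suff main n : forall p q a, (q <= n)%N -> (0 < q)%N ->
    value R a * q%:R = p%:R -> exists k b, forall i, a (k + i)%N = b.
  move=> /rationalP[p [q e]]; have v01 := value_in01 R a.
  case: (posnP q) => [q0|q0].
    by exists 0%N, true => i; apply: value_eq0; rewrite e q0 invr0 mulr0.
  apply: (main q `|p|%N q a) => //.
  have qR : 0 < q%:R :> R by rewrite ltr0n.
  have e' : value R a * q%:R = p%:~R by rewrite e divfK // gt_eqF.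
  have p0 : 0 <= p by rewrite -(ler0z R) -e'; apply: mulr_ge0; lra.
  by rewrite e' -{1}(gez0_abs p0).
elim: n => [|n IHn] p q {}a qn q0 e; first by move: q0; rewrite ltnNge qn.
have v01 := value_in01 R a; have w01 := value_in01 R (tail a).
have qR : 0 < q%:R :> R by rewrite ltr0n.
have pq : (p <= q)%N by rewrite -(ler_nat R) -e ler_piMl //; lra.
case: (posnP p) => [p0|p0].
  exists 0%N, true => i; apply: value_eq0; apply/eqP.
  by move/eqP: e; rewrite p0 mulf_eq0 (gt_eqF qR) orbF.
move: pq; rewrite leq_eqVlt => /predU1P[pq|pq].
  exists 0%N, false => i; apply: value_eq1.
  by apply: (mulIf (lt0r_neq0 qR)); rewrite e pq mul1r.
have pR : 0 < p%:R :> R by rewrite ltr0n.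
suff [k [b h]] : exists k b, forall i, tail a (k + i)%N = b.
  by exists k.+1, b => i; exact: h.
move: e; rewrite value_branch; case: (a 0%N) => /= e.
  apply: (IHn p (q - p)%N (tail a)); [lia|lia|].
  rewrite natrB; last exact: ltnW.
  rewrite -{}e; move: (value R _) w01 => v w01; field; lra.
apply: (IHn (2 * p - q)%N p (tail a)); [lia|lia|].
have e' : q%:R = p%:R * (2 - value R (tail a)).
  by rewrite -e mulrAC mulVf ?mul1r //; lra.
have e2 : value R (tail a) * p%:R = 2 * p%:R - q%:R by rewrite e'; ring.
rewrite natrB ?natrM // -(ler_nat R) natrM -subr_ge0 -e2.
by apply: mulr_ge0; lra.
Qed.

Lemma nobleP x : noble x <-> exists p q r s : int,
  (p * s - q * r) \is a GRing.unit /\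
  x = (p%:~R * golden R + q%:~R) / (r%:~R * golden R + s%:~R).
Proof.
have det2 (M : 'M[int]_2) : \det M = M 0 0 * M 1 1 - M 0 1 * M 1 0.
  rewrite (expand_det_row _ 0) !big_ord_recl big_ord0 addr0 /cofactor.
  rewrite !det_mx11 !mxE !lift0 /= expr0 expr1 mul1r mulrA mulrN1.
  rewrite mulNr.
  by congr (M _ _ * M _ _ - M _ _ * M _ _); exact/val_inj.
split=> [[M [Mu ->]]|[p [q [r [s [u ->]]]]]].
  exists (M 0 0), (M 0 1), (M 1 0), (M 1 1); split => //.
  by rewrite -det2 -unitmxE.
exists (\matrix_(i, j) if i == 0 then if j == 0 then p else q
                       else if j == 0 then r else s).
by rewrite unitmxE det2 /mobius !mxE.
Qed.

Lemma noble_golden : noble (golden R).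
Proof.
apply/nobleP; exists 1, 0, 0, 1; split => //.
by rewrite mul0r add0r addr0 mul1r divr1.
Qed.

(** That x is nonzero excludes a null denominator, with no appeal to the
    irrationality of the golden section. *)
Lemma noble_add1 x : x != 0 -> noble x -> noble (x + 1).
Proof.
move=> x0 /nobleP[p [q [r [s [u e]]]]]; apply/nobleP.
exists (p + r), (q + s), r, s; split.
  by rewrite (_ : _ - _ = p * s - q * r) //; ring.
have d0 : r%:~R * golden R + s%:~R != 0.
  by apply: contra_neq x0 => d0; rewrite e d0 invr0 mulr0.
by rewrite e !rmorphD /=; field.
Qed.

Lemma nobleV x : noble x -> noble x^-1.
Proof.
move=> /nobleP[p [q [r [s [u e]]]]]; apply/nobleP; exists r, s, p, q.
rewrite e invf_div; split => //.
by rewrite (_ : _ - _ = - (p * s - q * r)) ?unitrN //; ring.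
Qed.

Lemma nobleN x : noble x -> noble (- x).
Proof.
move=> /nobleP[p [q [r [s [u e]]]]]; apply/nobleP; exists (- p), (- q), r, s.
split; last by rewrite e -mulNr !rmorphN /= opprD mulNr.
by rewrite (_ : _ - _ = - (p * s - q * r)) ?unitrN //; ring.
Qed.

Lemma golden_gt0 : 0 < golden R.
Proof. by rewrite /golden; have := sqrtr_ge0 (5 : R); lra. Qed.

Lemma golden_sqr : golden R ^+ 2 = golden R + 1.
Proof.
have := sqr_sqrtr (ler0n R 5); rewrite /golden.
by move: (Num.sqrt _) => u; rewrite !expr2 => e; lra.
Qed.

(** The string phi satisfies phi = 0 (complement of phi), which in the
    coordinate x reads x = 1 + 1 / x. *)
Lemma value_phi : value R phi = unit_coord (golden R).
Proof.
have tphi : tail phi = complement phi by [].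
have := value_branch R phi; rewrite tphi value_compl /= => {tphi}.
have := value_in01 R phi; have := golden_sqr; have := golden_gt0.
rewrite /unit_coord; move: (value R phi) (golden R) => v g g0 g2 v01 e.
have {}e : v * (1 + v) = 1.
  by rewrite {1}e; field; lra.
have u1 : g / (1 + g) = g^-1.
  by rewrite addrC -g2; field; lra.
rewrite u1; have gi : 0 < g^-1 by rewrite invr_gt0.
have {}g2 : g^-1 * (1 + g^-1) = 1.
  have -> : g^-1 * (1 + g^-1) = (g + 1) / g ^+ 2 by field; lra.
  by rewrite g2 divff //; lra.
move: (g^-1) gi g2 => u u0 u2; nra.
Qed.

Lemma alternating_tail_noble k c a : (forall i, a (k + i)%N = odd i (+) c) ->
  exists x, [/\ 0 < x, noble x & value R a = unit_coord x].
Proof.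
elim: k a => [|k IHk] a ha.
  have g0 := golden_gt0; case: c ha => ha.
    exists (golden R)^-1; rewrite invr_gt0 g0; split => //.
      exact/nobleV/noble_golden.
    have -> : a = complement phi.
      by apply/funext => i; rewrite -[i]add0n ha addbT.
    by rewrite value_compl value_phi /unit_coord; field; apply/andP; split; lra.
  exists (golden R); split => //; first exact: noble_golden.
  have -> : a = phi by apply/funext => i; rewrite -[i]add0n ha addbF.
  exact: value_phi.
have [x [x0 xn vx]] := IHk (tail a) ha.
rewrite value_branch vx; case: (a 0%N) => /=.
  (* Letter 1 is letter 0 conjugated by inversion. *)
  exists (x^-1 + 1)^-1; have xi : 0 < x^-1 by rewrite invr_gt0.
  split; first by rewrite invr_gt0; lra.
    by apply/nobleV/noble_add1; [lra|exact: nobleV].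
  by rewrite /unit_coord; field; apply/and3P; split; lra.
exists (x + 1); split; first lra.
  by apply: noble_add1 => //; lra.
by rewrite /unit_coord; field; apply/andP; split; lra.
Qed.

(** The coordinates of J(x) are rational functions of [twist a], where [a] is a
    code of x.  A rational [twist a] makes the xor of [a] with 0101...
    eventually constant, and then [a] eventually alternates, like the code of
    the golden section.  Negative numbers are handled by [J_opp]. *)
Lemma J_irrational x : irrational x -> ~ noble x ->
  exists2 beta, J x = Some beta & irrational beta.
Proof.
wlog x0 : x / 0 < x => [hw|] xi xn.
  have [x0|x0] := ltP 0 x; first exact: hw.
  have {}x0 : x < 0.
    by rewrite lt_neqAle x0 (irrational_neq xi (rational_nat R 0)).
  have [|||b Jb bi] := hw (- x); first by lra.
  - exact: irrationalN.
  - by move/nobleN; rewrite opprK.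
  have h : homogeneous (J (- x)) b 1 by rewrite Jb /= oner_neq0 mulr1.
  have := J_opp (irrationalN xi) h; rewrite opprK.
  case: (J x) => [r|] /= [b0 e].
    exists r => // rr; apply: bi; have -> : b = - r^-1.
      have r0 : r != 0 by apply: contra_eq_neq e => ->; rewrite mul0r; lra.
      by apply: (mulfI r0); rewrite -e; field.
    exact/rationalN/rationalV.
  by case: (irrational_neq bi (rational_nat R 0)); rewrite e eqxx.
have [a va] := exists_code_pos x0; have := J_pos x0 xi va.
have [tr|ti] := pselect (rational (twist R a)).
  have [k [b h]] := rational_value_eventually_constant tr.
  case: xn; have [i|y [y0 yn vy]] := @alternating_tail_noble k (b (+) odd k) a.
    have := h i; rewrite /xorS /phi oddD => <-.
    by case: (a _) (odd k) (odd i) => [] [] [].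
  by rewrite (@unit_coord_inj _ x y) // -va.
case: (J x) => [r|] /= [t0 e].
  exists r => // rr; apply: ti; have r1 : 1 + r != 0.
    by apply/eqP => r1; move: e; rewrite (_ : r = -1); lra.
  have -> : twist R a = r / (1 + r).
    by apply: (mulIf r1); rewrite divfK //; lra.
  exact: rationalM rr (rationalV (rationalD (rational1 R) rr)).
by case: ti; rewrite (_ : twist R a = 1); [exact: rational1|lra].
Qed.

End Noble.

(** * Periodicity of the expansion of a pair of conjugates *)

Section Lagrange.
Variable R : realType.
Implicit Types (x y z : R).

Definition strip b x : R := if b then x / (1 - x) else x - 1.

(** The first component chooses the letter that is removed from both. *)
Definition strip_pair (s : R * R) : R * R :=
  (strip (s.1 < 1) s.1, strip (s.1 < 1) s.2).

(** The discriminant [D] of the common equation does not change when letters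
    are removed; requiring it to be nonzero is how the equation is kept from
    being trivial. *)
Definition quadratic_pair (D : int) (s : R * R) : Prop :=
  [/\ 0 < s.1, irrational s.1, irrational s.2, s.1 != s.2 /\ D != 0 &
    exists A B C : int, [/\ B ^+ 2 - 4 * A * C = D,
      A%:~R * s.1 ^+ 2 + B%:~R * s.1 + C%:~R = 0 &
      A%:~R * s.2 ^+ 2 + B%:~R * s.2 + C%:~R = 0]].

Lemma irrational_strip b x : irrational x -> irrational (strip b x).
Proof.
move=> xi xr; apply: xi; case: b xr => /= xr; last first.
  by rewrite -(subrK 1 x); exact: rationalD xr (rational1 R).
have [->|x1] := eqVneq x 1; first exact: rational1.
have -> : x = (x / (1 - x)) / (1 + x / (1 - x)).
  by field; rewrite subrK oner_neq0 andbT subr_eq0 eq_sym.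
exact: rationalM xr (rationalV (rationalD (rational1 R) xr)).
Qed.

Lemma strip_inj b x y : irrational x -> irrational y ->
  strip b x = strip b y -> x = y.
Proof.
move=> xi yi.
have x1 := irrational_neq xi (rational1 R).
have y1 := irrational_neq yi (rational1 R).
case: b => /= e; last by lra.
have := congr1 (fun u => u * ((1 - x) * (1 - y))) e.
have -> : x / (1 - x) * ((1 - x) * (1 - y)) = x * (1 - y).
  by field; rewrite subr_eq0 eq_sym.
have -> : y / (1 - y) * ((1 - x) * (1 - y)) = y * (1 - x).
  by field; rewrite subr_eq0 eq_sym.
lra.
Qed.

Lemma strip_form b (A B C : R) x : x != 1 ->
  A * x ^+ 2 + B * x + C = 0 ->
  (if b then A + B + C else A) * strip b x ^+ 2
  + (if b then B + 2 * C else 2 * A + B) * strip b x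
  + (if b then C else A + B + C) = 0.
Proof.
move=> x1 e; case: b => /=; last by rewrite -e; ring.
by rewrite -[RHS](mul0r ((1 - x) ^- 2)) -e; field; rewrite subr_eq0 eq_sym.
Qed.

Lemma quadratic_pair_strip D s :
  quadratic_pair D s -> quadratic_pair D (strip_pair s).
Proof.
case: s => y z [/= y0 yi zi [yz D0] [A [B [C [d ey ez]]]]].
have y1 := irrational_neq yi (rational1 R).
have z1 := irrational_neq zi (rational1 R).
split => /=.
- case: (ltgtP y 1) y1 => // h _ /=; last by lra.
  by rewrite divr_gt0 //; lra.
- exact: irrational_strip.
- exact: irrational_strip.
- by split => //; apply: contra_neq yz => /strip_inj ->.
have := strip_form (y < 1) y1 ey; have := strip_form (y < 1) z1 ez.
case: (y < 1) => e1 e2.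
  exists (A + B + C), (B + 2 * C), C; split; first by rewrite -d; ring.
    by rewrite !rmorphD !rmorphM.
  by rewrite !rmorphD !rmorphM.
exists A, (2 * A + B), (A + B + C); split; first by rewrite -d; ring.
  by rewrite !rmorphD !rmorphM.
by rewrite !rmorphD !rmorphM.
Qed.

Lemma quadratic_pair_iter D s n :
  quadratic_pair D s -> quadratic_pair D (iter n strip_pair s).
Proof. by move=> h; elim: n => //= n; exact: quadratic_pair_strip. Qed.

Lemma unit_coord_strip b x : 0 < x -> x != 1 -> 0 < strip b x ->
  unit_coord x = branch b (unit_coord (strip b x)).
Proof.
rewrite /unit_coord; case: b => /= x0 x1 s0; last by field; lra.
have x2 : 0 < 1 - x by move: s0; rewrite pmulr_rgt0 // invr_gt0.
by field; apply/andP; split; lra.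
Qed.

Lemma positive_pair_close D s n : quadratic_pair D s ->
  (forall k, 0 < (iter k strip_pair s).2) ->
  exists a u v, [/\ 0 <= u <= 1, 0 <= v <= 1,
    unit_coord s.1 = cylinder n a u & unit_coord s.2 = cylinder n a v].
Proof.
elim: n s => [|n IHn] s hs pos.
  exists phi, (unit_coord s.1), (unit_coord s.2); split=> //.
    by case: hs => ? *; exact: unit_coord_in01.
  exact: unit_coord_in01 (pos 0%N).
have hs' := quadratic_pair_strip hs.
have [|a [u [v [hu hv eu ev]]]] := IHn (strip_pair s) hs'.
  by move=> k; rewrite -iterSr.
exists (cons_string (s.1 < 1) a), u, v; split=> //=; rewrite -/(tail _).
  rewrite -eu; case: hs hs' => y0 yi _ _ _ [y0' _ _ _ _].
  by rewrite -unit_coord_strip //; exact: irrational_neq yi (rational1 R).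
rewrite -ev; have z0 := pos 0%N; have z0' := pos 1%N.
case: hs => _ _ zi _ _.
by rewrite -unit_coord_strip //; exact: irrational_neq zi (rational1 R).
Qed.

(** While both components are positive they have the same letters; if this
    lasted forever, they would have the same code and hence be equal. *)
Lemma exists_negative D s : quadratic_pair D s ->
  exists k, (iter k strip_pair s).2 < 0.
Proof.
move=> hs; apply/not_existsP => hn.
have pos k : 0 < (iter k strip_pair s).2.
  have [_ _ zi _ _] := quadratic_pair_iter k hs.
  have := irrational_neq zi (rational_nat R 0).
  by case: ltgtP (hn k) => // _ [].
have [y0 _ _ [/eqP yz _] _] := hs; apply: yz.
apply: unit_coord_inj => //; first exact: (pos 0%N).
apply: (@eq_of_near _ _ _ 1) => n.
have [a [u [v [hu hv -> ->]]]] := positive_pair_close n hs pos.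
by rewrite mul1r; exact: cylinder_width.
Qed.

Lemma negative_strip s : s.2 < 0 -> (strip_pair s).2 < 0.
Proof.
move=> z0; rewrite /= /strip; case: (s.1 < 1); last lra.
by rewrite pmulr_llt0 // invr_gt0; lra.
Qed.

(** Roots of opposite signs mean A C < 0, so that D = B^2 + 4 |A| |C| is a sum
    of nonnegative terms and bounds each coefficient. *)
Lemma reduced_bounds (D A B C : int) y z : z < 0 -> 0 < y -> D != 0 ->
  B ^+ 2 - 4 * A * C = D ->
  A%:~R * y ^+ 2 + B%:~R * y + C%:~R = 0 ->
  A%:~R * z ^+ 2 + B%:~R * z + C%:~R = 0 ->
  [/\ A != 0, - D <= A <= D, - D <= B <= D & - D <= C <= D].
Proof.
move=> z0 y0 D0 d ey ez.
have e1 : (y - z) * (A%:~R * y * z - C%:~R) = 0.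
  have -> : (y - z) * (A%:~R * y * z - C%:~R) =
    z * (A%:~R * y ^+ 2 + B%:~R * y + C%:~R) -
    y * (A%:~R * z ^+ 2 + B%:~R * z + C%:~R) by ring.
  by rewrite ey ez; ring.
have {}e1 : C%:~R = A%:~R * y * z.
  by move/eqP: e1; rewrite mulf_eq0 => /orP[/eqP|/eqP]; lra.
have A0 : A != 0.
  apply: contra_neq D0 => A0; rewrite A0 !mul0r in e1.
  move: ey; rewrite e1 A0 mul0r add0r addr0 => /eqP.
  rewrite mulf_eq0 (gt_eqF y0) orbF intr_eq0 => /eqP B0.
  by rewrite -d A0 B0; ring.
have AC : A * C < 0.
  rewrite -(ltrz0 R) rmorphM /= e1.
  have -> : A%:~R * (A%:~R * y * z) = A%:~R ^+ 2 * (y * z) by ring.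
  rewrite pmulr_rlt0; first by rewrite pmulr_rlt0.
  by rewrite exprn_even_gt0 //= intr_eq0.
have C0 : C != 0 by apply: contraTneq AC => ->; rewrite mulr0.
have A1 : 1 <= `|A| by rewrite -gtz0_ge1 normr_gt0.
have C1 : 1 <= `|C| by rewrite -gtz0_ge1 normr_gt0.
have eD : D = `|B| ^+ 2 + 4 * (`|A| * `|C|).
  by rewrite -normrM ltr0_norm // -d real_normK ?num_real //; ring.
have lA : `|A| <= `|A| * `|C| by rewrite ler_peMr.
have lC : `|C| <= `|A| * `|C| by rewrite ler_peMl.
have lB : `|B| <= `|B| ^+ 2.
  have [->|B0] := eqVneq B 0; first by rewrite normr0.
  by rewrite expr2 ler_peMr // -gtz0_ge1 normr_gt0.
by split=> //; rewrite -ler_norml eD; lia.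
Qed.

Lemma roots_determined (A B C : R) y z y' z' : A != 0 ->
  z < 0 -> 0 < y -> z' < 0 -> 0 < y' ->
  A * y ^+ 2 + B * y + C = 0 -> A * z ^+ 2 + B * z + C = 0 ->
  A * y' ^+ 2 + B * y' + C = 0 -> A * z' ^+ 2 + B * z' + C = 0 ->
  y = y' /\ z = z'.
Proof.
move=> A0 z0 y0 z0' y0' ey ez ey' ez'.
have eB : B = - A * (y + z).
  have : (y - z) * (A * (y + z) + B) = 0.
    have -> : (y - z) * (A * (y + z) + B) =
      (A * y ^+ 2 + B * y + C) - (A * z ^+ 2 + B * z + C) by ring.
    by rewrite ey ez subrr.
  by move/eqP; rewrite mulf_eq0 => /orP[/eqP|/eqP]; lra.
have fact w : A * w ^+ 2 + B * w + C = 0 -> (w - y) * (w - z) = 0.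
  move=> ew; apply: (mulfI A0); rewrite mulr0.
  have -> : A * ((w - y) * (w - z)) =
    (A * w ^+ 2 + B * w + C) - (A * y ^+ 2 + B * y + C) by rewrite eB; ring.
  by rewrite ew ey subrr.
move: (fact _ ey') (fact _ ez') => /eqP + /eqP; rewrite !mulf_eq0.
by move=> /orP[/eqP|/eqP] + /orP[/eqP|/eqP]; lra.
Qed.

(** From some rank on the second component is negative, and there are finitely
    many equations of discriminant [D] with roots of opposite signs.  Two ranks
    thus share their equation, and the signs tell its two roots apart. *)
Lemma exists_period D s : quadratic_pair D s ->
  exists k n, iter (k + n.+1) strip_pair s = iter k strip_pair s.
Proof.
move=> hs; have [K zK] := exists_negative hs.
pose S i := iter (K + i) strip_pair s.
have hS i : quadratic_pair D (S i) by exact: quadratic_pair_iter.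
have nS i : (S i).2 < 0.
  elim: i => [|i IHi]; first by rewrite /S addn0.
  by rewrite /S addnS; exact: negative_strip IHi.
(* Each coefficient lies between - |D| and |D|; it is stored shifted by |D|. *)
pose N := `|D|%N.*2.+1.
have /choice[f hf] i : exists t : 'I_N * 'I_N * 'I_N,
    let c (u : 'I_N) := (u : nat)%:Z - `|D|%:Z in
    let A := (c t.1.1)%:~R : R in let B := (c t.1.2)%:~R in
    let C := (c t.2)%:~R in
    [/\ A != 0, A * (S i).1 ^+ 2 + B * (S i).1 + C = 0 &
        A * (S i).2 ^+ 2 + B * (S i).2 + C = 0].
  have [y0 _ _ [_ D0] [A [B [C [d ey ez]]]]] := hS i.
  have [A0 bA bB bC] := reduced_bounds (nS i) y0 D0 d ey ez.
  have code (X : int) : - D <= X <= D ->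
      exists u : 'I_N, (u : nat)%:Z - `|D|%:Z = X.
    move=> bX; have lt : (absz (X + `|D|%:Z)%R < N)%N by rewrite /N; lia.
    by exists (Ordinal lt) => /=; lia.
  have [u eu] := code A bA; have [v ev] := code B bB; have [w ew] := code C bC.
  by exists (u, v, w); rewrite /= eu ev ew intr_eq0.
pose M := (N * N * N)%N.
have /injectivePn[i [j ij fij]] :
    ~~ injectiveb (fun i : 'I_M.+1 => f (i : nat)).
  apply/negP => /injectiveP /leq_card.
  by rewrite !card_prod !card_ord ltnn.
have eS : S i = S j.
  have := hf i; have := hf j; rewrite fij /= => -[A0 e1 e2] [_ e3 e4].
  have [y0 _ _ _ _] := hS i; have [y0' _ _ _ _] := hS j.
  have [] := roots_determined A0 (nS i) y0 (nS j) y0' e3 e4 e1 e2.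
  by case: (S i) (S j) => ? ? [? ?] /= -> ->.
wlog lt : i j ij eS {fij} / (i < j)%N => [hw|].
  case: (ltngtP i j) => h; first exact: hw eS h.
    by apply: hw (esym eS) h; rewrite eq_sym.
  by case/eqP: ij; apply/val_inj.
exists (K + i)%N, (j - i).-1.
rewrite prednK ?subn_gt0 // -addnA subnKC ?(ltnW lt) //.
Qed.

End Lagrange.

Arguments strip_pair {R} s.

(** * The quadratic form killing both images *)

Section Period.
Variable R : realType.
Implicit Types (x y z : R) (s : R * R).

(** The matrix (p q; r t) sends coordinates of J(x') to coordinates of J(x). *)
Definition transports (p q r t : nat) x' x : Prop :=
  forall u v, homogeneous (J x') u v ->
    homogeneous (J x) (p%:R * u + q%:R * v) (r%:R * u + t%:R * v).

Lemma strip_unstrip b x : irrational x ->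
  x = if b then ((strip b x)^-1 + 1)^-1 else strip b x + 1.
Proof.
move=> xi; have x0 := irrational_neq xi (rational_nat R 0).
have x1 := irrational_neq xi (rational1 R).
case: b => /=; last by rewrite subrK.
by rewrite invf_div; field; rewrite subrK oner_neq0 x0.
Qed.

Lemma J_strip b x u v : irrational x -> homogeneous (J (strip b x)) u v ->
  if b then homogeneous (J x) v (u + v) else homogeneous (J x) (u + v) u.
Proof.
move=> xi; have si := irrational_strip (b := b) xi.
case: b si => /= si h; last by have := J_add1 si h; rewrite subrK.
have sVi := irrationalV si.
have := J_inv (irrational_addr1 sVi) (J_add1 sVi (J_inv si h)).
by rewrite -(strip_unstrip true xi) addrC.
Qed.

(** Each letter contributes a left factor (1 1; 1 0) or (0 1; 1 1).  For the
    product of such a factor with a nonnegative matrix to be scalar, a column of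
    the latter would have to vanish; this is why the determinant is kept nonzero
    along the induction. *)
Lemma transports_iter D s n : quadratic_pair D s -> exists p q r t : nat,
  [/\ (p * t != q * r)%N, ((0 < n) ==> ~~ [&& q == 0, r == 0 & p == t])%N,
    transports p q r t (iter n strip_pair s).1 s.1 &
    transports p q r t (iter n strip_pair s).2 s.2].
Proof.
elim: n s => [|n IHn] s hs.
  exists 1%N, 0%N, 0%N, 1%N; split => // u v;
    by rewrite !mul1r !mul0r addr0 add0r.
have [p [q [r [t [det _ h1 h2]]]]] := IHn _ (quadratic_pair_strip hs).
have [_ yi zi _ _] := hs.
rewrite -iterSr in h1 h2.
have := fun u v h => J_strip (b := s.1 < 1) yi (h1 u v h).
have := fun u v h => J_strip (b := s.1 < 1) zi (h2 u v h).
move: (iter n.+1 _ _) => s'.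
case: (s.1 < 1) => k2 k1.
  exists r, t, (p + r)%N, (q + t)%N; split.
  - by move: det; lia.
  - by move: det; lia.
  - move=> u v /k1 h; apply: (homogeneous_eq h (oner_neq0 _));
      by rewrite ?natrD; ring.
  - move=> u v /k2 h; apply: (homogeneous_eq h (oner_neq0 _));
      by rewrite ?natrD; ring.
exists (p + r)%N, (q + t)%N, p, q; split.
- by move: det; lia.
- by move: det; lia.
- move=> u v /k1 h; apply: (homogeneous_eq h (oner_neq0 _));
    by rewrite ?natrD; ring.
- move=> u v /k2 h; apply: (homogeneous_eq h (oner_neq0 _));
    by rewrite ?natrD; ring.
Qed.

(** One choice of homogeneous coordinates is enough: the form is homogeneous. *)
Definition form_vanishes (A B C : int) (h : hatR R) : Prop :=
  exists u v, homogeneous h u v /\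
    A%:~R * u ^+ 2 + B%:~R * (u * v) + C%:~R * v ^+ 2 = 0.

(** J(x) and J(z) are zeros of one nonzero integral binary quadratic form.  This
    property, unlike periodicity, passes from a tail to the whole number. *)
Definition J_share_form x z : Prop := exists A B C : int,
  [/\ ~~ [&& A == 0, B == 0 & C == 0], form_vanishes A B C (J x) &
    form_vanishes A B C (J z)].

Lemma share_form_add1 x z : irrational x -> irrational z ->
  J_share_form x z -> J_share_form (x + 1) (z + 1).
Proof.
move=> xi zi [A [B [C [n0 [u [v [hx ex]]] [u' [v' [hz ez]]]]]]].
exists C, (B - 2 * C), (A - B + C); split; first by move: n0; lia.
  exists (u + v), u; split; first exact: J_add1.
  by rewrite -ex !rmorphD !rmorphN !rmorphM /=; ring.
exists (u' + v'), u'; split; first exact: J_add1.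
by rewrite -ez !rmorphD !rmorphN !rmorphM /=; ring.
Qed.

Lemma share_formV x z : irrational x -> irrational z ->
  J_share_form x z -> J_share_form x^-1 z^-1.
Proof.
move=> xi zi [A [B [C [n0 [u [v [hx ex]]] [u' [v' [hz ez]]]]]]].
exists C, B, A; split; first by move: n0; lia.
  by exists v, u; split; [exact: J_inv|rewrite -ex; ring].
by exists v', u'; split; [exact: J_inv|rewrite -ez; ring].
Qed.

Lemma share_formN x z : irrational x -> irrational z ->
  J_share_form x z -> J_share_form (- x) (- z).
Proof.
move=> xi zi [A [B [C [n0 [u [v [hx ex]]] [u' [v' [hz ez]]]]]]].
exists C, (- B), A; split; first by move: n0; lia.
  by exists (- v), u; split; [exact: J_opp|rewrite -ex rmorphN /=; ring].
by exists (- v'), u'; split; [exact: J_opp|rewrite -ez rmorphN /=; ring].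
Qed.

Lemma share_form_strip b x z : irrational x -> irrational z ->
  J_share_form (strip b x) (strip b z) -> J_share_form x z.
Proof.
move=> xi zi; rewrite {2}(strip_unstrip b xi) {2}(strip_unstrip b zi).
have := irrational_strip (b := b) xi; have := irrational_strip (b := b) zi.
case: b => szi sxi h; last exact: share_form_add1.
apply: share_formV; try exact/irrational_addr1/irrationalV.
by apply: share_form_add1; try exact: irrationalV; exact: share_formV.
Qed.

(** A nonzero vector (u, v) is an eigenvector of (p q; r t) exactly when it is a
    zero of the form u (r u + t v) - v (p u + q v), which is nonzero unless the
    matrix is scalar. *)
Lemma share_form_periodic D s n : quadratic_pair D s ->
  iter n.+1 strip_pair s = s -> J_share_form s.1 s.2.
Proof.
move=> hs e; have [p [q [r [t [_ ns]]]]] := transports_iter n.+1 hs.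
rewrite e => h1 h2; exists r%:Z, (t%:Z - p%:Z), (- q%:Z).
have key x : transports p q r t x x ->
    form_vanishes r%:Z (t%:Z - p%:Z) (- q%:Z) (J x).
  move=> hx; have [u [v huv]] := homogeneous_exists (J x).
  have [c [_ e1 e2]] := homogeneous_unique huv (hx u v huv).
  exists u, v; split => //; rewrite rmorphB rmorphN /=.
  transitivity (u * (r%:R * u + t%:R * v) - v * (p%:R * u + q%:R * v)).
    by ring.
  by rewrite e1 e2; ring.
by split; [move: ns; lia|exact: key|exact: key].
Qed.

Lemma share_form_iter D s k : quadratic_pair D s ->
  J_share_form (iter k strip_pair s).1 (iter k strip_pair s).2 ->
  J_share_form s.1 s.2.
Proof.
elim: k s => // k IHk s hs; rewrite iterSr => h.
have h' := IHk _ (quadratic_pair_strip hs) h.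
by case: hs => _ yi zi _ _; exact: share_form_strip h'.
Qed.

Lemma share_form_pair D s : quadratic_pair D s -> J_share_form s.1 s.2.
Proof.
move=> hs; have [k [n e]] := exists_period hs.
apply: (share_form_iter (k := k) hs).
apply: (share_form_periodic (n := n) (quadratic_pair_iter k hs)).
by rewrite -iterD addnC.
Qed.

End Period.

(** * Conjugates *)

Section Conjugate.
Variable R : realType.
Implicit Types (x y z : R).

Lemma quadratic_root_coefs (P : {poly rat}) x : quadratic_root P x ->
  P`_2 != 0 /\ ratr P`_2 * x ^+ 2 + ratr P`_1 * x + ratr P`_0 = 0.
Proof.
move=> [sP /rootP e]; split.
  by have := lead_coef_eq0 P; rewrite lead_coefE sP /= -size_poly_eq0 sP => ->.
rewrite -[RHS]e horner_coef size_map_poly sP !big_ord_recl big_ord0 !coef_map.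
by rewrite /= /bump /=; ring.
Qed.

Lemma quadratic_root_intro (A B C : rat) x : A != 0 ->
  ratr A * x ^+ 2 + ratr B * x + ratr C = 0 ->
  quadratic_root (Poly [:: C; B; A]) x.
Proof.
move=> A0 e; have sP : Poly [:: C; B; A] = [:: C; B; A] :> seq rat.
  by rewrite (PolyK (c := C)).
split; first by rewrite sP.
apply/rootP; rewrite -e horner_coef size_map_poly sP /= !big_ord_recl big_ord0.
by rewrite !coef_map sP /= /bump /=; ring.
Qed.

Lemma clear_denominators (a b c : rat) : a != 0 -> exists A B C : int,
  A != 0 /\ exists d : rat,
    [/\ A%:~R = d * a, B%:~R = d * b & C%:~R = d * c].
Proof.
move=> a0.
exists (numq a * denq b * denq c), (numq b * denq a * denq c).
exists (numq c * denq a * denq b).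
split; first by rewrite !mulf_neq0 ?denq_neq0 // numq_eq0.
exists (denq a * denq b * denq c)%:~R.
have num u : (numq u)%:~R = u * (denq u)%:~R :> rat by rewrite numqE.
by split; rewrite !rmorphM /= !num; ring.
Qed.

Lemma quadratic_irrational_form x : quadratic_irrational x ->
  exists A B C : int, A != 0 /\ A%:~R * x ^+ 2 + B%:~R * x + C%:~R = 0.
Proof.
move=> [xi [P /quadratic_root_coefs[a0 e]]].
have [A [B [C [A0 [d [eA eB eC]]]]]] := clear_denominators P`_1 P`_0 a0.
exists A, B, C; split => //.
rewrite -[A%:~R](ratr_int R) -[B%:~R](ratr_int R) -[C%:~R](ratr_int R) eA eB eC.
by rewrite !rmorphM /= -[RHS](mulr0 (ratr d)) -e; ring.
Qed.

(** Any quadratic polynomial over the rationals that vanishes at the irrational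
    x is proportional to the given one, so its other root is the same. *)
Lemma conjugateE (A B C : int) x z : A != 0 -> irrational x -> z != x ->
  A%:~R * x ^+ 2 + B%:~R * x + C%:~R = 0 ->
  A%:~R * z ^+ 2 + B%:~R * z + C%:~R = 0 ->
  quadratic_irrational x /\ conjugate x = z.
Proof.
move=> A0 xi zx ex ez.
have AQ : (A%:~R : rat) != 0 by rewrite intr_eq0.
have AR : (A%:~R : R) != 0 by rewrite intr_eq0.
have root (w : R) : A%:~R * w ^+ 2 + B%:~R * w + C%:~R = 0 ->
    quadratic_root (Poly [:: C%:~R; B%:~R; A%:~R]) w.
  by move=> ew; apply: quadratic_root_intro => //; rewrite !ratr_int.
split; first by split=> //; exists (Poly [:: C%:~R; B%:~R; A%:~R]); exact: root.
apply: get_unique => /=.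
  split=> //; exists (Poly [:: C%:~R; B%:~R; A%:~R]).
  by split; exact: root.
have sum (a b c : R) w : w != x -> a != 0 -> a * x ^+ 2 + b * x + c = 0 ->
    a * w ^+ 2 + b * w + c = 0 -> w = - (b / a) - x.
  move=> wx a0 e1 e2.
  have : (w - x) * (a * (w + x) + b) = 0.
    have -> : (w - x) * (a * (w + x) + b) =
      (a * w ^+ 2 + b * w + c) - (a * x ^+ 2 + b * x + c) by ring.
    by rewrite e1 e2 subrr.
  move/eqP; rewrite mulf_eq0 subr_eq0 (negPf wx) /= => /eqP e.
  have -> : b = - (a * (w + x)) by lra.
  by field.
move=> w [wx [P [/quadratic_root_coefs[a0 e1] /quadratic_root_coefs[_ e2]]]].
have aR : (ratr P`_2 : R) != 0 by rewrite fmorph_eq0.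
rewrite (sum _ _ _ _ wx aR e1 e2) (sum _ _ _ _ zx AR ex ez).
(* If the two monic equations had distinct linear coefficients, their
   difference would express x rationally. *)
congr (- _ - _); apply/eqP; rewrite -subr_eq0; apply/negPn/negP => n0.
move: P`_2 P`_1 P`_0 e1 a0 aR n0 {e2} => a b c e1 a0 aR n0.
apply: xi.
have rA := rational_int R A; have rB := rational_int R B.
have rC := rational_int R C; have ra := rational_rat R a.
have rb := rational_rat R b; have rc := rational_rat R c.
have rD : rational (ratr b / ratr a - B%:~R / A%:~R : R).
  apply/rationalD/rationalN; first exact: rationalM rb (rationalV ra).
  exact: rationalM rB (rationalV rA).
have rE : rational (C%:~R / A%:~R - ratr c / ratr a : R).
  apply/rationalD/rationalN; first exact: rationalM rC (rationalV rA).
  exact: rationalM rc (rationalV ra).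
have -> : x = (C%:~R / A%:~R - ratr c / ratr a) /
              (ratr b / ratr a - B%:~R / A%:~R).
  apply: (mulIf n0); rewrite divfK //.
  have -> : C%:~R = - (A%:~R * x ^+ 2 + B%:~R * x) :> R by lra.
  have -> : ratr c = - (ratr a * x ^+ 2 + ratr b * x) :> R by lra.
  by field; rewrite aR.
exact: rationalM rE (rationalV rD).
Qed.

Lemma conjugates_share_form x (A B C : int) : irrational x -> A != 0 ->
  A%:~R * x ^+ 2 + B%:~R * x + C%:~R = 0 ->
  let z := - (B%:~R / A%:~R) - x in
  [/\ irrational z, z != x, A%:~R * z ^+ 2 + B%:~R * z + C%:~R = 0 &
    J_share_form x z].
Proof.
move=> xi A0 ex z.
have AR : (A%:~R : R) != 0 by rewrite intr_eq0.
have rBA : rational (- (B%:~R / A%:~R) : R).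
  by apply/rationalN/rationalM; [|apply: rationalV]; exact: rational_int.
have zi : irrational z.
  move=> zr; apply: xi; have -> : x = - (B%:~R / A%:~R) - z by rewrite /z; ring.
  exact: rationalD rBA (rationalN zr).
have ez : A%:~R * z ^+ 2 + B%:~R * z + C%:~R = 0.
  by rewrite -ex /z; field.
have zx : z != x.
  apply/eqP => zx; apply: xi; have -> : x = - (B%:~R / A%:~R) / 2.
    by move: zx; rewrite /z; lra.
  exact: rationalM rBA (rationalV (rational_nat R 2)).
split=> //.
have D0 : B ^+ 2 - 4 * A * C != 0.
  rewrite -(intr_eq0 R).
  have -> : (B ^+ 2 - 4 * A * C)%:~R = (A%:~R * (x - z)) ^+ 2 :> R.
    rewrite rmorphB rmorphXn !rmorphM /=.
    have -> : C%:~R = - (A%:~R * x ^+ 2 + B%:~R * x) :> R by lra.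
    by rewrite /z; field.
  by rewrite expf_neq0 // mulf_neq0 // subr_eq0 eq_sym.
have x0 : x != 0 := irrational_neq xi (rational_nat R 0).
case: (ltgtP x 0) x0 => [xneg|xpos|->] // _; last first.
  apply: (@share_form_pair _ (B ^+ 2 - 4 * A * C) (x, z)).
  by split => //; [rewrite eq_sym|exists A, B, C].
rewrite -(opprK x) -(opprK z); apply: share_formN; try exact: irrationalN.
apply: (@share_form_pair _ (B ^+ 2 - 4 * A * C) (- x, - z)).
split=> /=; [by rewrite oppr_gt0|exact: irrationalN|exact: irrationalN| |].
  by rewrite eqr_opp eq_sym.
exists A, (- B), C; split; first by rewrite sqrrN.
  by rewrite -ex rmorphN /=; ring.
by rewrite -ez rmorphN /=; ring.
Qed.

End Conjugate.

Theorem theorem1 (R : realType) (alpha : R)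
  (alpha_quadratic : quadratic_irrational alpha)
  (alpha_not_noble : ~ noble alpha) :
  exists beta : R, J alpha = Some beta /\ quadratic_irrational beta /\
    J (conjugate alpha) = Some (conjugate beta).
Proof.
have [ai _] := alpha_quadratic.
have [A [B [C [A0 ea]]]] := quadratic_irrational_form alpha_quadratic.
have [] := conjugates_share_form ai A0 ea; move: (- _ - _) => z zi za ez rel.
have [_ ->] := conjugateE A0 ai za ea ez.
have [beta Jb bi] := J_irrational ai alpha_not_noble.
exists beta; split=> //.
have [A' [B' [C' [n0 [u [v [hb e1]]] [u' [v' [hz e2]]]]]]] := rel.
rewrite Jb /= in hb; case: hb => v0 eu.
have eb : A'%:~R * beta ^+ 2 + B'%:~R * beta + C'%:~R = 0.
  apply: (mulfI (expf_neq0 2 v0)); rewrite mulr0 -e1 eu; ring.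
have A'0 : A' != 0.
  apply/eqP => A'0; rewrite A'0 mul0r add0r in eb.
  have B'0 : B' != 0.
    apply/eqP => B'0; move: eb; rewrite B'0 mul0r add0r => /eqP.
    by rewrite intr_eq0 => C'0; move: n0; rewrite A'0 B'0 C'0.
  apply: bi; have -> : beta = - C'%:~R / B'%:~R.
    have BR : (B'%:~R : R) != 0 by rewrite intr_eq0.
    by apply: (mulfI BR); rewrite mulrCA divff ?mulr1 //; lra.
  apply: rationalM; first exact/rationalN/rational_int.
  exact/rationalV/rational_int.
case Jz: (J z) hz => [g|] /= [w0 ew].
  have eg : A'%:~R * g ^+ 2 + B'%:~R * g + C'%:~R = 0.
    apply: (mulfI (expf_neq0 2 w0)); rewrite mulr0 -e2 ew; ring.
  have gb : g != beta.
    apply/eqP => gb; rewrite gb in Jz; case/eqP: za.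
    exact: J_irrational_inj bi Jz Jb.
  by have [? ->] := conjugateE A'0 bi gb eb eg.
(* At infinity the form takes the value A' u'^2, which is not zero. *)
move/eqP: e2; rewrite ew mulr0 expr0n /= !mulr0 !addr0 mulf_eq0 intr_eq0.
by rewrite (negPf A'0) expf_eq0 /= (negPf w0).
Qed.
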